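(* Let $(x_n)_{n=1}^\infty$ be a normalized $K$-unconditional basic sequence in $\ell_1$ (so $\|x_n\|_{\ell_1}=1$ for all $n$). If, for some $1<p\le\infty$, $$\inf_{n\in\mathbb N}\|x_n\|_{\ell_p}>0,$$ then $(x_n)_{n=1}^\infty$ is $(k,1)$-equivalent to the standard unit vector basis of $\ell_1$, where $$k=\frac{1}{K\sqrt2}\,\inf_{n\in\mathbb N}\|x_n\|_{\ell_2}.$$
   Context: All spaces and scalars are real. For $x\in\ell_1$ and $1\le p\le\infty$, $\|x\|_{\ell_p}$ denotes the $\ell_p$-norm of the same sequence $x$, i.e. the $\ell_p$-norm of its image under the formal identity operator $\ell_1\to\ell_p$. A basic sequence $(x_n)$ in $\ell_1$ is $K$-unconditional if it is an unconditional basic sequence with unconditional basis constant $K$, where the unconditional basis constant is the smallest constant $K$ such that $\|\sum_{n=1}^m\epsilon_n\alpha_nx_n\|\le K\|\sum_{n=1}^m\alpha_nx_n\|$ for all finite sequences of signs $\epsilon_n\in\{-1,1\}$ and of real scalars $\alpha_n$. For positive numbers $K_1,K_2$, a sequence $(x_n)$ in a Banach space $X$ is $(K_1,K_2)$-equivalent to a sequence $(y_n)$ in $X$ if, for every finite sequence of scalars $(\alpha_n)_{n=1}^m$, $K_1\|\sum_{n=1}^m\alpha_n y_n\|_X\le\|\sum_{n=1}^m\alpha_nx_n\|_X\le K_2\|\sum_{n=1}^m\alpha_ny_n\|_X$. *)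

(* Defs.v *)
From HB Require Import structures.
From mathcomp Require Import all_boot all_order all_algebra.
From mathcomp Require Import all_classical all_reals all_analysis.

Set Implicit Arguments.
Unset Strict Implicit.
Unset Printing Implicit Defensive.

Import Order.TTheory GRing.Theory Num.Theory.
Import numFieldNormedType.Exports.

Local Open Scope classical_set_scope.
Local Open Scope ring_scope.

Section BasicSequences.
Context {R : realType} {V : normedModType R}.
Implicit Types (x y : nat -> V) (a : nat -> R) (K : R).

Definition lin_span x : set V :=
  [set v | exists m a, v = \sum_(n < m) a n *: x n].

(* Intended for W a closed linear subspace of V. *)
Definition schauder_basis_of (W : set V) x : Prop :=
  (forall n, W (x n)) /\
  forall v, W v -> exists! a, series (fun n => a n *: x n) @ \oo --> v.

Definition basic_sequence x : Prop := schauder_basis_of (closure (lin_span x)) x.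

(* Every rearrangement of the series converges. *)
Definition unconditionally_cvg (u : nat -> V) : Prop :=
  forall s : nat -> nat, bijective s -> cvgn (series (u \o s)).

Definition unconditional_basic_sequence x : Prop :=
  basic_sequence x /\
  forall a, cvgn (series (fun n => a n *: x n)) ->
    unconditionally_cvg (fun n => a n *: x n).

Definition sign_bounds x : set R :=
  [set K | forall (m : nat) (eps : nat -> bool) a,
    `|\sum_(n < m) ((-1) ^+ eps n * a n) *: x n|
      <= K * `|\sum_(n < m) a n *: x n|].

(* The constant is the least admissible K, not merely an upper bound. *)
Definition unconditional_basis_constant x K : Prop :=
  sign_bounds x K /\ lbound (sign_bounds x) K.

Definition K_unconditional K x : Prop :=
  unconditional_basic_sequence x /\ unconditional_basis_constant x K.

Definition equivalent_seq K1 K2 x y : Prop :=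
  [/\ 0 < K1, 0 < K2 &
    forall (m : nat) a,
      K1 * `|\sum_(n < m) a n *: y n| <= `|\sum_(n < m) a n *: x n|
        <= K2 * `|\sum_(n < m) a n *: y n| ].

End BasicSequences.

Section EllOne.
Context (R : realType).

(* Functions rather than ae-classes: the counting measure has no nonempty null
   set, so the norm is definite. *)
Definition ell1 : Type := LfunType (@counting nat R) (lexx 1%E).

HB.instance Definition _ := GRing.Lmodule.on ell1.

(* For p = +oo the library's norm is the essential sup, here the plain sup. *)
Definition lp_norm (p : \bar R) (x : ell1) : \bar R :=
  'N[@counting nat R]_p[EFin \o x].

Definition ell1_norm (x : ell1) : R := fine (lp_norm 1%E x).

Lemma ell1_normE (x : ell1) : (ell1_norm x)%:E = lp_norm 1%E x.
Proof. exact: (finite_norm_fine x). Qed.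

Lemma lp_norm1E (x : ell1) : lp_norm 1%E x = (\sum_(j <oo) `|x j|%:E)%E.
Proof. by rewrite /lp_norm Lnorm1 ge0_integral_count. Qed.

Lemma ler_ell1_normD x y : ell1_norm (x + y) <= ell1_norm x + ell1_norm y.
Proof. exact: (@ler_LnormD _ _ _ (@counting nat R) _ (lexx 1%E) x y). Qed.

Lemma ell1_normZ (a : R) x : ell1_norm (a *: x) = `|a| * ell1_norm x.
Proof.
apply: EFin_inj; rewrite EFinM !ell1_normE.
exact: (@LnormZ _ _ _ (@counting nat R) _ (lexx 1%E) x a).
Qed.

Lemma ell1_norm_eq0 x : ell1_norm x = 0 -> x = 0.
Proof.
move=> x0; apply/LfuneqP => j.
have := ell1_normE x; rewrite x0 lp_norm1E => /esym s0.
have : (`|x j|%:E <= \sum_(k <oo) `|x k|%:E)%E.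
  by rewrite (nneseriesD1 (n := j))// leeDl// nneseries_ge0.
by rewrite s0 lee_fin normr_le0 => /eqP.
Qed.

HB.instance Definition _ := Lmodule_isNormed.Build R ell1
  ler_ell1_normD ell1_normZ ell1_norm_eq0.

Lemma unit_vector_Lfun (n : nat) :
  (fun j : nat => (j == n)%:R : R) \in Lfun (@counting nat R) 1%E.
Proof.
apply/andP; split; rewrite inE//=.
rewrite /finite_norm Lnorm1 ge0_integral_count// (nneseriesD1 (n := n))//.
rewrite eseries0 ?adde0 ?ltry// => k _ /andP[_ kn] /=.
by rewrite (negPf kn) normr0.
Qed.

Definition unit_vector (n : nat) : ell1 := Lfun_Sub (lexx 1%E) (unit_vector_Lfun n).

Lemma unit_vectorE n j : unit_vector n j = (j == n)%:R.
Proof. by []. Qed.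

End EllOne.

(* Main.v *)
Require Import Defs.
From mathcomp Require Import all_boot all_order all_algebra.
From mathcomp Require Import all_classical all_reals all_analysis.
From mathcomp Require Import ring lra.
Import Order.TTheory GRing.Theory Num.Theory.
Import numFieldNormedType.Exports.
Local Open Scope classical_set_scope.
Local Open Scope ring_scope.

(** The lower estimate is an averaging argument. Fix scalars [a_n] and a sign
    vector [s] on the first [N] coordinates, and let [S_n] be the signed sum
    of the coordinates [s_j * x_n(j)]. Choosing the sign of the [n]-th term to
    be that of [a_n * S_n] and testing the resulting vector of [ell_1] against
    [s] gives [sum_n |a_n| |S_n| <= K * norm (sum_n a_n x_n)]; this is
    [sign_bounds_sum_le]. Now average over [s]. Khintchine's inequality with
    Szarek's optimal constant, [||b||_2 <= sqrt 2 * E|sum_j s_j b_j|], bounds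
    the mean of [|S_n|] below by the [ell_2] norm of the first [N] coordinates
    of [x_n] divided by [sqrt 2], and [N] tends to infinity
    ([sum_l2_norm_le]).

    Khintchine's inequality is proved following Latala and Oleszkiewicz. Let
    [f s = |sum_j s_j b_j|] on the discrete cube and let [L] be the Laplacian
    whose eigenvalue on a Walsh function is its degree. Convexity gives
    [L f <= f] pointwise, so [E(f L f) <= E(f^2)]. Since [f] is even it has no
    Walsh component of degree one, so the Poincare inequality improves to
    [2 Var f <= E(f L f)] ([poincare_level2], [level1_weight_even]).
    Together, [E(f^2) <= 2 (E f)^2], where [E(f^2) = ||b||_2^2].

    The constant is positive because, on the unit sphere of [ell_1], a lower
    bound on the [ell_p] norm for some [p > 1] forces one on the largest
    coordinate, through [||x||_p^p <= ||x||_oo^(p-1) ||x||_1], and hence one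
    on the [ell_2] norm ([l2_norm_ge_of_lp_norm_ge]). The upper estimate is
    the triangle inequality. *)

(** * Analysis on the discrete cube *)

Section SignCube.
Context {R : realType}.
Implicit Types (f g h F G : seq bool -> R) (a : nat -> R) (n : nat) (s : seq bool).

(** Mean of [F] over the [2 ^ n] sign vectors of length [n]. A sign vector is
    encoded as a list of booleans, [true] standing for the sign [-1]. *)
Fixpoint sign_mean n F : R :=
  if n is n'.+1 then
    (sign_mean n' (fun s => F (false :: s))
     + sign_mean n' (fun s => F (true :: s))) / 2
  else F [::].

Lemma eq_sign_mean n F G : {in [pred s | size s == n], F =1 G} ->
  sign_mean n F = sign_mean n G.
Proof.
elim: n F G => [|n IH] F G FG /=; first exact: FG.
by congr ((_ + _) / 2); apply: IH => s sn; exact: FG.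
Qed.

Lemma le_sign_mean n F G : {in [pred s | size s == n], forall s, F s <= G s} ->
  sign_mean n F <= sign_mean n G.
Proof.
elim: n F G => [|n IH] F G FG /=; first exact: FG.
by rewrite ler_pM2r ?invr_gt0// lerD//; apply: IH => s sn; exact: FG.
Qed.

Lemma sign_mean_cst n c : sign_mean n (fun=> c) = c.
Proof. by elim: n => //= n ->; field. Qed.

Lemma sign_meanD n F G :
  sign_mean n (fun s => F s + G s) = sign_mean n F + sign_mean n G.
Proof. by elim: n F G => //= n IH F G; rewrite !IH; field. Qed.

Lemma sign_meanZ n c F : sign_mean n (fun s => c * F s) = c * sign_mean n F.
Proof. by elim: n F => //= n IH F; rewrite !IH; field. Qed.

Lemma sign_mean_sum n m (c : nat -> R) (F : nat -> seq bool -> R) :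
  sign_mean n (fun s => \sum_(k < m) c k * F k s) =
  \sum_(k < m) c k * sign_mean n (F k).
Proof.
elim: m => [|m IH].
  rewrite big_ord0 -[RHS](sign_mean_cst n).
  by apply: eq_sign_mean => s _; rewrite big_ord0.
rewrite big_ord_recr /= -IH -sign_meanZ -sign_meanD.
by apply: eq_sign_mean => s _; rewrite big_ord_recr.
Qed.

(** The Laplacian [L f s], half the sum over the coordinates [j] of
    [f s - f s'], where [s'] is [s] with its [j]-th sign flipped. It multiplies
    a Walsh function by its degree. *)
Fixpoint sign_laplacian n f s : R :=
  match n, s with
  | n'.+1, b :: s' => sign_laplacian n' (fun t => f (b :: t)) s'
                     + (f (b :: s') - f (~~ b :: s')) / 2
  | _, _ => 0
  end.

(** The Dirichlet form [E(f * L f)], written as a quarter of the sum over the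
    coordinates of the mean squared jumps; see [sign_mean_mul_laplacian]. *)
Fixpoint dirichlet n f : R :=
  if n is n'.+1 then
    (dirichlet n' (fun s => f (false :: s))
     + dirichlet n' (fun s => f (true :: s))) / 2
    + sign_mean n' (fun s => (f (false :: s) - f (true :: s)) ^+ 2) / 4
  else 0.

(** Sum of the squares of the Walsh coefficients of degree one of [f]: the one
    of the first coordinate is the mean of its odd part in that coordinate, and
    the others are those of its even part. *)
Fixpoint level1_weight n f : R :=
  if n is n'.+1 then
    level1_weight n' (fun s => (f (false :: s) + f (true :: s)) / 2)
    + (sign_mean n' (fun s => (f (false :: s) - f (true :: s)) / 2)) ^+ 2
  else 0.

Lemma eq_dirichlet n f g : (forall s, f s = g s) -> dirichlet n f = dirichlet n g.
Proof. by move=> /funext ->. Qed.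

Lemma dirichlet_parallelogram n f g :
  dirichlet n (fun s => f s + g s) + dirichlet n (fun s => f s - g s) =
  2 * (dirichlet n f + dirichlet n g).
Proof.
elim: n f g => [|n IH] f g /=; first by ring.
have mean2 :
    sign_mean n (fun s => (f (false :: s) + g (false :: s)
                           - (f (true :: s) + g (true :: s))) ^+ 2)
    + sign_mean n (fun s => (f (false :: s) - g (false :: s)
                             - (f (true :: s) - g (true :: s))) ^+ 2)
  = 2 * (sign_mean n (fun s => (f (false :: s) - f (true :: s)) ^+ 2)
         + sign_mean n (fun s => (g (false :: s) - g (true :: s)) ^+ 2)).
  rewrite -!sign_meanD -sign_meanZ; apply: eq_sign_mean => s _; ring.
have F0 := IH (fun s => f (false :: s)) (fun s => g (false :: s)).
have F1 := IH (fun s => f (true :: s)) (fun s => g (true :: s)).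
by lra.
Qed.

Lemma sign_mean_mul_laplacian n f :
  sign_mean n (fun s => f s * sign_laplacian n f s) = dirichlet n f.
Proof.
elim: n f => [|n IH] f /=; first by rewrite mulr0.
have split b : sign_mean n (fun s => f (b :: s) *
      (sign_laplacian n (fun t => f (b :: t)) s + (f (b :: s) - f (~~ b :: s)) / 2))
    = dirichlet n (fun s => f (b :: s))
      + 2^-1 * sign_mean n (fun s => f (b :: s) * (f (b :: s) - f (~~ b :: s))).
  rewrite -IH -sign_meanZ -sign_meanD; apply: eq_sign_mean => s _.
  by field.
have cross : sign_mean n (fun s => (f (false :: s) - f (true :: s)) ^+ 2) =
    sign_mean n (fun s => f (false :: s) * (f (false :: s) - f (true :: s)))
    + sign_mean n (fun s => f (true :: s) * (f (true :: s) - f (false :: s))).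
  by rewrite -sign_meanD; apply: eq_sign_mean => s _; ring.
have /= s0 := split false; have /= s1 := split true.
by rewrite s0 s1 cross; field.
Qed.

(** Here and in the next lemmas, [f] is split into its even part [g] and its odd
    part [h] in the first coordinate. *)
Lemma dirichletS n f :
  let g s := (f (false :: s) + f (true :: s)) / 2 in
  let h s := (f (false :: s) - f (true :: s)) / 2 in
  dirichlet n.+1 f = dirichlet n g + dirichlet n h + sign_mean n (fun s => h s ^+ 2).
Proof.
move=> g h /=.
have := dirichlet_parallelogram n g h.
rewrite (@eq_dirichlet n _ (fun s => f (false :: s))); last first.
  by move=> s; rewrite /g /h; field.
rewrite (@eq_dirichlet n (fun s => g s - h s) (fun s => f (true :: s))); last first.
  by move=> s; rewrite /g /h; field.
move=> ->; rewrite [X in _ + X = _]mulrC -sign_meanZ; congr (_ + _); first by field.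
by apply: eq_sign_mean => s _; rewrite /h; field.
Qed.

Lemma sign_mean_sqrS n f :
  let g s := (f (false :: s) + f (true :: s)) / 2 in
  let h s := (f (false :: s) - f (true :: s)) / 2 in
  sign_mean n.+1 (fun s => f s ^+ 2) =
  sign_mean n (fun s => g s ^+ 2) + sign_mean n (fun s => h s ^+ 2).
Proof.
move=> g h /=; rewrite -!sign_meanD mulrC -sign_meanZ.
by apply: eq_sign_mean => s _; rewrite /g /h; field.
Qed.

Lemma sign_meanS n f :
  sign_mean n.+1 f = sign_mean n (fun s => (f (false :: s) + f (true :: s)) / 2).
Proof.
rewrite /= -sign_meanD mulrC -sign_meanZ; apply: eq_sign_mean => s _.
by rewrite mulrC.
Qed.

Lemma poincare n f :
  sign_mean n (fun s => f s ^+ 2) - sign_mean n f ^+ 2 <= dirichlet n f.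
Proof.
elim: n f => [|n IH] f; first by rewrite /= subrr.
rewrite dirichletS sign_mean_sqrS sign_meanS /=.
have Ig := IH (fun s => (f (false :: s) + f (true :: s)) / 2).
have Ih := IH (fun s => (f (false :: s) - f (true :: s)) / 2).
have h0 : 0 <= dirichlet n (fun s => (f (false :: s) - f (true :: s)) / 2).
  elim: n {Ig Ih IH} (fun s => (f (false :: s) - f (true :: s)) / 2) => //= n IH h.
  rewrite addr_ge0// ?divr_ge0// ?addr_ge0//.
  by rewrite -[leLHS](sign_mean_cst n); apply: le_sign_mean => s _; rewrite sqr_ge0.
lra.
Qed.

(** The spectral gap is at least two once the degree-one part is removed. *)
Lemma poincare_level2 n f :
  2 * (sign_mean n (fun s => f s ^+ 2) - sign_mean n f ^+ 2) - level1_weight n f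
  <= dirichlet n f.
Proof.
elim: n f => [|n IH] f; first by rewrite /= !subrr mulr0 subrr.
rewrite dirichletS sign_mean_sqrS sign_meanS.
have Ig := IH (fun s => (f (false :: s) + f (true :: s)) / 2).
have Ih := poincare n (fun s => (f (false :: s) - f (true :: s)) / 2).
rewrite /=; lra.
Qed.

Lemma sign_mean_negb n F : sign_mean n (fun s => F (map negb s)) = sign_mean n F.
Proof.
elim: n F => //= n IH F.
rewrite (IH (fun s => F (true :: s))) (IH (fun s => F (false :: s))).
by rewrite addrC.
Qed.

Lemma level1_weight_even n f :
  {in [pred s | size s == n], forall s, f (map negb s) = f s} -> level1_weight n f = 0.
Proof.
elim: n f => //= n IH f fE; rewrite IH ?add0r; last first.
  by move=> s sn; rewrite -(fE (false :: s))// -(fE (true :: s))//= addrC.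
set h := fun s => _.
suff hN : sign_mean n h = - sign_mean n h.
  by rewrite (_ : sign_mean n h = 0) ?expr0n//; lra.
rewrite -{1}sign_mean_negb -mulN1r -sign_meanZ; apply: eq_sign_mean => s sn.
have sn' : size (map negb s) == n by rewrite size_map.
by rewrite /h -(fE (false :: map _ s))// -(fE (true :: map _ s))//= (mapK negbK); ring.
Qed.

(** The Rademacher sum [sum_(j < n) s_j a_j]. *)
Definition sign_sum n a s := \sum_(j < n) (-1) ^+ nth false s j * a j.

Lemma sign_sumS n a b s :
  sign_sum n.+1 a (b :: s) = (-1) ^+ b * a 0%N + sign_sum n (fun j => a j.+1) s.
Proof. by rewrite /sign_sum big_ord_recl. Qed.

Lemma sign_sum_negb n a :
  {in [pred s | size s == n], forall s,
    sign_sum n a (map negb s) = - sign_sum n a s}.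
Proof.
move=> s /eqP sn; rewrite /sign_sum -sumrN; apply: eq_bigr => j _.
rewrite (nth_map false) ?sn//.
by case: (nth _ _ _); rewrite /= ?expr0 ?expr1; ring.
Qed.

Lemma sign_mean_sum_sqr n a c :
  sign_mean n (fun s => (c + sign_sum n a s) ^+ 2) = c ^+ 2 + \sum_(j < n) a j ^+ 2.
Proof.
elim: n a c => [|n IH] a c; first by rewrite /= /sign_sum !big_ord0 !addr0.
have E b : sign_mean n (fun s => (c + sign_sum n.+1 a (b :: s)) ^+ 2) =
    (c + (-1) ^+ b * a 0%N) ^+ 2 + \sum_(j < n) a j.+1 ^+ 2.
  by rewrite -(IH (fun j => a j.+1)); apply: eq_sign_mean => s _; rewrite sign_sumS addrA.
by rewrite /= !E big_ord_recl /= expr0 expr1; field.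
Qed.

(** Convexity of the absolute value: flipping the sign of a summand [u] changes
    the absolute value of a sum [S] by at least [- 2 * sg S * u]. At [c = 0]
    the right-hand side is the absolute value itself; the shift [c] makes the
    induction on the coordinates possible. *)
Lemma laplacian_normr_le n a c s : size s = n ->
  sign_laplacian n (fun t => `|c + sign_sum n a t|) s <=
  Num.sg (c + sign_sum n a s) * sign_sum n a s.
Proof.
elim: n a c s => [|n IH] a c s; first by rewrite /= /sign_sum big_ord0 mulr0.
case: s => [|b s]//= [sn]; rewrite sign_sumS (_ : (fun t => _) = fun t =>
   `|(c + (-1) ^+ b * a 0%N) + sign_sum n (fun j => a j.+1) t|); last first.
  by apply/funext => t; rewrite sign_sumS addrA.
have := IH (fun j => a j.+1) (c + (-1) ^+ b * a 0%N) s sn.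
rewrite !sign_sumS !addrA.
set T := sign_sum _ _ _; set u := (-1) ^+ b * _; set S := c + u + T.
have -> : c + (-1) ^+ (~~ b) * a 0%N + T = S - 2 * u.
  by rewrite /S /u; case: b {S u IH} => /=; rewrite ?expr0 ?expr1; ring.
have : Num.sg S * (S - 2 * u) <= `|S - 2 * u|.
  apply: le_trans (ler_norm _) _; rewrite normrM normr_sg.
  by case: (S == 0) => /=; rewrite ?mul0r ?mul1r.
have := normrEsg S.
lra.
Qed.

(** The [L_1]-[L_2] Khintchine inequality with its optimal constant. *)
Lemma khintchine n a :
  Num.sqrt (\sum_(j < n) a j ^+ 2) <=
  Num.sqrt 2 * sign_mean n (fun s => `|sign_sum n a s|).
Proof.
pose f s := `|sign_sum n a s|.
have m0 : 0 <= sign_mean n f.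
  by rewrite -[leLHS](sign_mean_cst n); apply: le_sign_mean => s _; exact: normr_ge0.
have f2 : sign_mean n (fun s => f s ^+ 2) = \sum_(j < n) a j ^+ 2.
  have := sign_mean_sum_sqr n a 0; rewrite expr0n add0r => <-.
  by apply: eq_sign_mean => s _; rewrite /f add0r real_normK ?num_real.
have le_f : dirichlet n f <= sign_mean n (fun s => f s ^+ 2).
  rewrite -sign_mean_mul_laplacian; apply: le_sign_mean => s /eqP sn.
  rewrite expr2 ler_wpM2l ?normr_ge0//.
  have := laplacian_normr_le n a 0 s sn; rewrite add0r -normrEsg.
  by under eq_fun do rewrite add0r.
have := poincare_level2 n f; rewrite level1_weight_even; last first.
  by move=> s sn; rewrite /f sign_sum_negb// normrN.
rewrite subr0 => le2.
have S0 : 0 <= \sum_(j < n) a j ^+ 2 by apply: sumr_ge0 => j _; exact: sqr_ge0.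
rewrite -(@ler_pXn2r _ 2)// ?nnegrE ?mulr_ge0 ?sqrtr_ge0//.
by rewrite exprMn !sqr_sqrtr// -f2; lra.
Qed.

End SignCube.

(** * Norms of absolutely summable sequences *)

Lemma ell1_norm_series (R : realType) (x : ell1 R) :
  `|x|%:E = (\sum_(j <oo) `|x j|%:E)%E.
Proof. by rewrite -lp_norm1E -ell1_normE. Qed.

Lemma ell1_sum_le (R : realType) (x : ell1 R) N : \sum_(j < N) `|x j| <= `|x|.
Proof.
rewrite -lee_fin ell1_norm_series -sumEFin -(big_mkord xpredT (fun j => `|x j|%:E)).
exact: nneseries_lim_ge.
Qed.

Lemma ell1_sum_coord (R : realType) (a : nat -> R) (x : nat -> ell1 R) m j :
  (\sum_(n < m) a n *: x n : ell1 R) j = \sum_(n < m) a n * x n j.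
Proof.
elim: m => [|m IH]; first by rewrite !big_ord0.
by rewrite !big_ord_recr /= -IH.
Qed.

Lemma unit_vector_norm (R : realType) n : `|unit_vector R n| = 1.
Proof.
apply: EFin_inj; rewrite ell1_norm_series (nneseriesD1 (n := n))// eseries0 ?adde0.
  by rewrite unit_vectorE eqxx normr1.
by move=> k _ /andP[_ /negPf kn]; rewrite unit_vectorE kn normr0.
Qed.

Lemma unit_vector_sum_norm (R : realType) (a : nat -> R) m :
  `|\sum_(n < m) a n *: unit_vector R n| = \sum_(n < m) `|a n|.
Proof.
apply/eqP; rewrite eq_le; apply/andP; split.
  apply: le_trans (ler_norm_sum _ _ _) _; apply: ler_sum => n _.
  by rewrite normrZ unit_vector_norm mulr1.
apply: le_trans (ell1_sum_le _ _ m); apply: ler_sum => j _.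
rewrite ell1_sum_coord (bigD1 j)// unit_vectorE eqxx mulr1 big1 => [|i ij].
  by rewrite [X in _ <= `|X|]addr0.
by rewrite unit_vectorE eq_sym (inj_eq val_inj) (negPf ij) mulr0.
Qed.

(** [||x||_p^p <= ||x||_oo^(p-1) ||x||_1]. *)
Lemma series_powR_le (R : realType) (x : ell1 R) (c p : R) :
  1 < p -> (forall j, `|x j| <= c) ->
  (\sum_(j <oo) (`|x j| `^ p)%:E <= (c `^ (p - 1) * `|x|)%:E)%E.
Proof.
move=> p1 xc; rewrite EFinM ell1_norm_series -nneseriesZl//.
apply: lee_nneseries => [j _ _|j _]; first by rewrite lee_fin powR_ge0.
rewrite -EFinM lee_fin -(mulrC `|x j|).
rewrite (_ : `|x j| `^ p = `|x j| * `|x j| `^ (p - 1)).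
  rewrite ler_wpM2l// ge0_ler_powR// ?nnegrE ?subr_ge0 ?(ltW p1)//.
  exact: le_trans (normr_ge0 _) (xc j).
by rewrite mulr_powRB1// (lt_trans ltr01).
Qed.

Lemma lp_normE (R : realType) (x : ell1 R) (p : R) : 0 < p ->
  lp_norm p%:E x = ((\sum_(j <oo) (`|x j| `^ p)%:E) `^ p^-1)%E.
Proof. by move=> p0; rewrite /lp_norm Lnorm_counting. Qed.

Lemma normr_coord_le (R : realType) (x : ell1 R) j : `|x j| <= `|x|.
Proof.
by apply: le_trans (ell1_sum_le _ _ j.+1); rewrite big_ord_recr /= lerDr sumr_ge0.
Qed.

(** The [ell_2] norm of an [ell_1] sequence is finite, and it is the limit of
    the Euclidean norms of its truncations. *)
Lemma cvg_l2_norm (R : realType) (x : ell1 R) :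
  lp_norm 2%:E x \is a fin_num /\
  Num.sqrt (\sum_(j < N) x j ^+ 2) @[N --> \oo] --> fine (lp_norm 2%:E x).
Proof.
have S_lt : (\sum_(j <oo) (`|x j| `^ 2)%:E < +oo)%E.
  apply: le_lt_trans (@series_powR_le _ _ `|x| _ _ _) (ltry _).
    by rewrite ltr1n.
  exact: normr_coord_le.
have S_ge : (0 <= \sum_(j <oo) (`|x j| `^ 2)%:E)%E.
  by apply: nneseries_ge0 => j _ _; rewrite lee_fin powR_ge0.
rewrite lp_normE//.
case SE : (\sum_(j <oo) (`|x j| `^ 2)%:E)%E S_lt S_ge => [S| |]// _ S0.
rewrite poweR12_sqrt//=; split => //.
apply: (cvg_comp (fun N => \sum_(j < N) x j ^+ 2) Num.sqrt); last first.
  exact: sqrt_continuous.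
have := @is_cvg_nneseries R (fun j => (`|x j| `^ 2)%:E) xpredT 0.
move=> /(_ _)/cvg_ex[]; first by move=> j _ _; rewrite lee_fin powR_ge0.
move=> l /[dup] cl /cvg_lim; rewrite SE => /(_ _) lS.
have {}cl : (fun N => \sum_(0 <= j < N) (`|x j| `^ 2)%:E)%E @ \oo --> S%:E.
  by rewrite lS.
have -> : (fun N => \sum_(j < N) x j ^+ 2) =
    fun N => fine (\sum_(0 <= j < N) (`|x j| `^ 2)%:E)%E.
  apply/funext => N; rewrite sumEFin /= big_mkord; apply: eq_bigr => j _.
  by rewrite powR_mulrn// real_normK ?num_real.
exact: fine_cvg.
Qed.

Lemma normr_coord_le_l2 (R : realType) (x : ell1 R) j :
  `|x j| <= fine (lp_norm 2%:E x).
Proof.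
have [_ xl] := cvg_l2_norm R x.
rewrite -(cvg_lim (@Rhausdorff R) xl).
apply: limr_ge; first by apply/cvg_ex; exists (fine (lp_norm 2%:E x)).
near=> N; have jN : (j < N)%N by near: N; exact: nbhs_infty_gt.
rewrite -sqrtr_sqr ler_wsqrtr// (bigD1 (Ordinal jN))//= lerDl.
by apply: sumr_ge0 => i _; exact: sqr_ge0.
Unshelve. all: by end_near.
Qed.

(** The bound on the coordinates is the one for which [series_powR_le] yields
    exactly [r ^ p]. *)
Lemma lp_norm_le_of_coord_le (R : realType) (x : ell1 R) (p r : R) :
  1 < p -> 0 < r -> `|x| = 1 ->
  (forall j, `|x j| <= (r `^ p) `^ (p - 1)^-1) -> (lp_norm p%:E x <= r%:E)%E.
Proof.
move=> p1 r0 x1 xc; have p0 : 0 < p by rewrite (lt_trans ltr01).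
have := @series_powR_le R x _ p p1 xc.
rewrite x1 mulr1 -powRrM mulVf ?subr_eq0 ?gt_eqF// powRr1 ?powR_ge0// => Sr.
rewrite lp_normE//.
have -> : r%:E = ((r `^ p)%:E `^ p^-1)%E.
  by rewrite poweR_EFin -powRrM mulfV ?gt_eqF// powRr1// ltW.
apply: gt0_ler_poweR => //; first by rewrite invr_ge0 ltW.
- rewrite in_itv/= leey andbT.
  by apply: nneseries_ge0 => j _ _; rewrite lee_fin powR_ge0.
- by rewrite in_itv/= leey andbT lee_fin powR_ge0.
Qed.

(** On the unit sphere of [ell_1], a lower bound [d] on the [ell_p] norm gives a
    positive lower bound on the [ell_2] norm, depending on [p] and [d] only. *)
Lemma l2_norm_ge_of_lp_norm_ge (R : realType) (p d : \bar R) :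
  (1 < p)%E -> (0 < d)%E ->
  exists2 c : R, 0 < c & forall x : ell1 R, `|x| = 1 ->
    (d <= lp_norm p x)%E -> c <= fine (lp_norm 2%:E x).
Proof.
move=> p1 d0.
have [r r0 rd] : exists2 r : R, 0 < r & (r%:E < d)%E.
  case: d d0 => [d||]//; last by exists 1; rewrite ?ltry.
  by rewrite lte_fin => d0; exists (d / 2); rewrite ?lte_fin; lra.
(* If every coordinate is at most [c], the [ell_p] norm is at most [r < d]. *)
have [c c0 small] : exists2 c : R, 0 < c & forall x : ell1 R, `|x| = 1 ->
    (forall j, `|x j| <= c) -> (lp_norm p x <= r%:E)%E.
  case: p p1 => [p||]//.
    rewrite lte_fin => p1; exists ((r `^ p) `^ (p - 1)^-1); first by rewrite !powR_gt0.
    by move=> x; exact: lp_norm_le_of_coord_le.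
  move=> _; exists r => // x _ xr; rewrite /lp_norm unlock /=.
  case: ifPn => [mu0|_]; last by rewrite lee_fin ltW.
  apply/ess_sup_inf.ess_supP/nearW => j /=; rewrite lee_fin; exact: xr.
exists c => // x x1 dx; rewrite leNgt; apply/negP => xc.
have := small x x1 (fun j => ltW (le_lt_trans (normr_coord_le_l2 R x j) xc)).
by move=> /(le_trans dx)/(lt_le_trans rd); rewrite ltxx.
Qed.

(** * Unconditional sequences *)

Lemma sign_bounds_sum_le (R : realType) (K : R) (x : nat -> ell1 R) m N s
    (a : nat -> R) :
  sign_bounds x K ->
  \sum_(n < m) `|a n| * `|sign_sum N (x n) s| <= K * `|\sum_(n < m) a n *: x n|.
Proof.
move=> xK.
(* These signs turn every [a n * sign_sum N (x n) s] into its absolute value. *)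
pose eps n := a n * sign_sum N (x n) s < 0.
pose y : ell1 R := \sum_(n < m) ((-1) ^+ eps n * a n) *: x n.
have yE j : y j = \sum_(n < m) (-1) ^+ eps n * a n * x n j.
  exact: (ell1_sum_coord R (fun n => (-1) ^+ eps n * a n)).
apply: le_trans (xK m eps a); rewrite -/y.
have -> : \sum_(n < m) `|a n| * `|sign_sum N (x n) s| = sign_sum N y s.
  rewrite /sign_sum.
  under [RHS]eq_bigr do rewrite yE mulr_sumr.
  rewrite exchange_big /=; apply: eq_bigr => n _.
  rewrite -normrM.
  have -> : `|a n * sign_sum N (x n) s| = (-1) ^+ eps n * (a n * sign_sum N (x n) s).
    rewrite /eps; case: ltP => h; first by rewrite expr1 mulN1r ltr0_norm.
    by rewrite expr0 mul1r ger0_norm.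
  by rewrite /sign_sum !mulr_sumr; apply: eq_bigr => j _; ring.
apply: le_trans (ell1_sum_le _ _ N).
apply: ler_sum => j _; apply: le_trans (ler_norm _) _.
by rewrite normrM normrX normrN1 expr1n mul1r.
Qed.

Lemma sum_l2_norm_le (R : realType) (K : R) (x : nat -> ell1 R) m (a : nat -> R) :
  sign_bounds x K ->
  \sum_(n < m) `|a n| * fine (lp_norm 2%:E (x n)) <=
  K * Num.sqrt 2 * `|\sum_(n < m) a n *: x n|.
Proof.
move=> xK; pose t N n := Num.sqrt (\sum_(j < N) x n j ^+ 2).
have tl : \sum_(n < m) `|a n| * t N n @[N --> \oo] -->
    \sum_(n < m) `|a n| * fine (lp_norm 2%:E (x n)).
  apply: cvg_big => [|n _]; first exact: add_continuous.
  by apply: cvgMr; exact: (cvg_l2_norm R (x n)).2.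
rewrite -(cvg_lim (@Rhausdorff R) tl).
apply: limr_le; first by apply/cvg_ex; eexists; exact: tl.
near=> N.
apply: (@le_trans _ _ (Num.sqrt 2 * sign_mean N (fun s =>
    \sum_(n < m) `|a n| * `|sign_sum N (x n) s|))).
  rewrite (sign_mean_sum N m (fun n => `|a n|) (fun n s => `|sign_sum N (x n) s|)).
  rewrite mulr_sumr; apply: ler_sum => n _; rewrite mulrCA ler_wpM2l//.
  exact: khintchine.
rewrite [leRHS]mulrAC [leRHS]mulrC ler_wpM2l ?sqrtr_ge0//.
rewrite -[leRHS](sign_mean_cst N); apply: le_sign_mean => s _.
exact: sign_bounds_sum_le.
Unshelve. all: by end_near.
Qed.

Theorem theorem2 (R : realType) (K : R) (x : nat -> ell1 R)
  (x_normalized : forall n, `|x n| = 1)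
  (x_uncond : K_unconditional K x)
  (p : \bar R) (p_gt1 : (1 < p)%E)
  (inf_p_gt0 : (0 < ereal_inf (range (fun n => lp_norm p (x n))))%E) :
  equivalent_seq
    ((K * Num.sqrt 2)^-1 *
       fine (ereal_inf (range (fun n => lp_norm 2%:E (x n)))))
    1 x (unit_vector R).
Proof.
have [_ [xK _]] := x_uncond.
have K0 : 0 < K.
  have := xK 1%N (fun=> false) (fun=> 1).
  rewrite !big_ord1 expr0 mul1r scale1r x_normalized mulr1.
  exact: lt_le_trans.
have [c c0 l2_ge] := l2_norm_ge_of_lp_norm_ge R p _ p_gt1 inf_p_gt0.
have l2_fin n : lp_norm 2%:E (x n) \is a fin_num := (cvg_l2_norm R (x n)).1.
set I := ereal_inf (range (fun n => lp_norm 2%:E (x n))).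
have I_le n : (I <= lp_norm 2%:E (x n))%E by apply: ereal_inf_lbound; exists n.
have c_le : (c%:E <= I)%E.
  apply: le_ereal_inf_tmp => _ [n _ <-]; rewrite -(fineK (l2_fin n)) lee_fin.
  by apply: l2_ge => //; apply: ereal_inf_lbound; exists n.
have I_fin : I \is a fin_num.
  rewrite fin_numElt (lt_le_trans (ltNyr c))//=.
  by rewrite (le_lt_trans (I_le 0%N))// ltey_eq l2_fin.
have I0 : 0 < fine I by apply: lt_le_trans c0 _; rewrite -lee_fin fineK.
have Ks0 : 0 < K * Num.sqrt 2 by rewrite mulr_gt0// sqrtr_gt0.
split=> [||m a]; first by rewrite mulr_gt0// invr_gt0.
  exact: ltr01.
rewrite unit_vector_sum_norm mul1r; apply/andP; split; last first.
  apply: le_trans (ler_norm_sum _ _ _) _; apply: ler_sum => n _.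
  by rewrite normrZ x_normalized mulr1.
rewrite -mulrA ler_pdivrMl//; apply: le_trans (sum_l2_norm_le R K x m a xK).
rewrite mulr_sumr; apply: ler_sum => n _; rewrite mulrC ler_wpM2l//.
by rewrite fine_le.
Qed.
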